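(* Let $S$ and $T$ be disjoint finite sets. Let $m_S:S\to\mathbb{Z}_+$ be a function with $\sum_{s\in S}m_S(s)=\gamma$, and suppose $m_S(s)\le |T|$ for every $s\in S$. Let $p_T$ be a positively intersecting supermodular set-function on $T$ with $p_T(\emptyset)=0$. The following statements are equivalent. (A) There is a simple bipartite graph $G=(S,T;E)$ covering $p_T$ (i.e. $|\Gamma_G(Y)|\ge p_T(Y)$ for every $Y\subseteq T$) with $d_G(s)=m_S(s)$ for every $s\in S$. (B1) $\widetilde m_S(X)+\widetilde p_T(\mathcal T)-|\mathcal T|\,|X|\le\gamma$ for every subset $X\subseteq S$ and every subpartition $\mathcal T$ of $T$. (B2) $\sum_{i=1}^q p_T(T_i)\le \sum_{s\in S}\min\{m_S(s),q\}$ for every subpartition $\{T_1,\dots,T_q\}$ of $T$.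
   Context: A bipartite graph $G=(S,T;E)$ has colour classes $S,T$; it is simple if it has no parallel edges. $\Gamma_G(Y)$ denotes the set of nodes of $S$ adjacent to at least one node of $Y\subseteq T$, and $d_G(v)$ is the degree of $v$. For a function $m$ on a set, $\widetilde m(X)=\sum_{v\in X}m(v)$. A subpartition of a set is a family of pairwise disjoint nonempty subsets of it (the empty family is allowed); for a family $\mathcal F$, $\widetilde p(\mathcal F)=\sum_{W\in\mathcal F}p(W)$, which is $0$ for the empty family. A set-function $p$ on $T$ is positively intersecting supermodular if $p(X)+p(Y)\le p(X\cap Y)+p(X\cup Y)$ holds whenever $X\cap Y\neq\emptyset$, $p(X)>0$ and $p(Y)>0$.
   Formalization: The set-function p_T is taken to be integer-valued; for real-valued p_T the equivalence fails (S={s}, T={a,b}, m_S(s)=1, p_T({a})=p_T({b})=1/2, p_T(T)=0 satisfies (B1) and (B2) but not (A)). *)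

(* Defs.v *)
From mathcomp Require Import all_boot all_order all_algebra.

Set Implicit Arguments.
Unset Strict Implicit.
Unset Printing Implicit Defensive.

Import Order.TTheory GRing.Theory Num.Theory.

Local Open Scope ring_scope.

(* The node set is the disjoint sum of S and T; encoding E as a set of pairs
   excludes parallel edges, so every such graph is simple. *)
Record bigraph (S T : finType) := Bigraph { edges : {set S * T} }.

Section Bigraph.
Variables (S T : finType) (G : bigraph S T).

Definition nbrs (Y : {set T}) : {set S} :=
  [set s | [exists t in Y, (s, t) \in edges G]].

Definition degS (s : S) : nat := #|[set e in edges G | e.1 == s]|.

Definition covers (p : {set T} -> int) : Prop :=
  forall Y : {set T}, p Y <= #|nbrs Y|%:Z.

End Bigraph.

Definition pos_intersecting_supermodular (T : finType) (p : {set T} -> int) :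
    Prop :=
  forall X Y : {set T},
    X :&: Y != set0 -> 0 < p X -> 0 < p Y ->
    p X + p Y <= p (X :&: Y) + p (X :|: Y).

(* Pairwise disjoint nonempty sets are distinct, so a family of them is
   faithfully a set of sets. *)
Definition subpartition (T : finType) (F : {set {set T}}) : bool :=
  trivIset F && (set0 \notin F).

(* Main.v *)
(* The nodes of S are removed one at a time: a node s of degree m receives a
   neighbourhood Z with |Z| = m, and p is replaced by W |-> p W - [W meets Z],
   which is again positively intersecting supermodular.  With
   g q = \sum_(s' != s) min (m s') q, condition (B2) survives iff
   excess F := p~(F) - #{W in F meeting Z} - g #|F| <= 0 for every subpartition
   F.  Z is built element by element, keeping excess F <= mu = m - |Z|.  If no
   element can be added, each t in T has a family F_t with excess mu none of
   whose cells missed by Z contains t.  Uncrossing these |T| families, where g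
   being concave allows a pair of sizes to be replaced by a more spread pair,
   ends in a chain in which every cell of a family contains a cell of the next
   one.  A cell of the first family missed by Z then contains, through the
   chain, a point lying in a missed cell of every family; but the total excess
   with respect to any Z + t does not decrease under uncrossing, which excludes
   such a point. *)

Require Import Defs.
From mathcomp Require Import all_boot all_order all_algebra zify.

Set Implicit Arguments.
Unset Strict Implicit.
Unset Printing Implicit Defensive.

Import Order.TTheory GRing.Theory Num.Theory.

Local Open Scope ring_scope.

(** * Sums over families and operations on subpartitions *)

Definition total (T : finType) (f : {set T} -> int) (F : {set {set T}}) : int :=
  \sum_(W in F) f W.

Definition hit (T : finType) (Z W : {set T}) : int := (W :&: Z != set0)%:Z.

Definition size_sum (T : finType) (F : {set {set T}}) : nat :=
  \sum_(W in F) #|W|.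

Lemma total0 (T : finType) (f : {set T} -> int) : total f set0 = 0.
Proof. exact: big_set0. Qed.

Lemma totalD1 (T : finType) (f : {set T} -> int) (F : {set {set T}}) A :
  A \in F -> total f F = f A + total f (F :\ A).
Proof. exact: big_setD1. Qed.

Lemma totalU1 (T : finType) (f : {set T} -> int) (F : {set {set T}}) A :
  A \notin F -> total f (A |: F) = f A + total f F.
Proof. exact: big_setU1. Qed.

Lemma totalID (T : finType) (f : {set T} -> int) (F As : {set {set T}}) :
  As \subset F -> total f F = total f As + total f (F :\: As).
Proof. by move=> sAF; rewrite /total (big_setID As) /= (setIidPr sAF). Qed.

Lemma total_nat (T : finType) (f : {set T} -> nat) (F : {set {set T}}) :
  total (fun W => (f W)%:Z) F = (\sum_(W in F) f W)%N%:Z.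
Proof. by rewrite (big_morph Posz PoszD (erefl (Posz 0))). Qed.

Lemma total_card (T : finType) (F : {set {set T}}) :
  total (fun=> 1) F = #|F|%:Z.
Proof. by rewrite -sum1_card -total_nat. Qed.

Lemma total_size (T : finType) (F : {set {set T}}) :
  total (fun W => #|W|%:Z) F = (size_sum F)%:Z.
Proof. exact: total_nat. Qed.

Lemma subpartition_disjoint (T : finType) (F : {set {set T}}) (A B : {set T}) :
  subpartition F -> A \in F -> B \in F -> A :&: B != set0 -> A = B.
Proof.
move=> /andP[/trivIsetP tF _] AF BF; apply: contraNeq => nAB.
by rewrite setI_eq0 tF.
Qed.

Lemma subpartitionI (T : finType) (F : {set {set T}}) :
  (forall A B, A \in F -> B \in F -> A :&: B != set0 -> A = B) ->
  set0 \notin F -> subpartition F.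
Proof.
move=> dF nF; rewrite /subpartition nF andbT; apply/trivIsetP => A B AF BF.
by apply: contra_neqT; rewrite -setI_eq0; apply: dF.
Qed.

Lemma subpartition_neq0 (T : finType) (F : {set {set T}}) (A : {set T}) :
  subpartition F -> A \in F -> A != set0.
Proof. by move=> /andP[_ nF] AF; apply: contraNneq nF => <-. Qed.

Lemma subpartition_sub (T : finType) (F F' : {set {set T}}) :
  F' \subset F -> subpartition F -> subpartition F'.
Proof.
move=> sF /andP[tF nF]; apply/andP; split; first exact: trivIsetS tF.
by apply: contra nF; apply: (subsetP sF).
Qed.

Lemma subpartitionU1 (T : finType) (F : {set {set T}}) (A : {set T}) :
  subpartition F -> A != set0 -> (forall B, B \in F -> A :&: B = set0) ->
  subpartition (A |: F) /\ A \notin F.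
Proof.
move=> sF nA dA; split; last first.
  by apply/negP => AF; move: nA; rewrite -(setIid A) dA ?eqxx.
apply: subpartitionI => [B C|]; last first.
  by rewrite !inE negb_or eq_sym nA; case/andP: sF.
rewrite !inE => /predU1P[->|BF] /predU1P[->|CF] //.
- by rewrite dA ?eqxx.
- by rewrite setIC dA ?eqxx.
- exact: subpartition_disjoint sF BF CF.
Qed.

(** The identity is proved for every [f] because it serves for [p], for [hit Z], for cell sizes and,
    with [f] constantly 1, for the number of cells. *)
Lemma subpartition_refine (T : finType) (F As : {set {set T}}) (B : {set T}) :
  subpartition F -> B \in F -> subpartition As ->
  (forall A, A \in As -> B :&: A != set0) ->
  let F' : {set {set T}} := [set B :&: A | A in As] :|: F :\ B in
  subpartition F' /\
  forall f : {set T} -> int,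
    total f F' + f B = total f F + total (fun A => f (B :&: A)) As.
Proof.
move=> sF BF sA mA F'.
have inj : {in As &, injective (fun A => B :&: A)}.
  move=> A A' AA AA' eA; apply: (subpartition_disjoint sA AA AA' _).
  apply: contraNneq (mA _ AA) => AA'0; apply/eqP/setP => x.
  rewrite inE; have /setP/(_ x) := eA; have /setP/(_ x) := AA'0.
  by rewrite !inE; case: (x \in A); case: (x \in A'); case: (x \in B).
have sub_disj C : C \in F :\ B -> forall A, (B :&: A) :&: C = set0.
  move=> /setD1P[CB CF] A; apply/eqP; rewrite setIAC -subset0.
  apply: (subset_trans (subsetIl _ _)); rewrite subset0.
  by apply: contraNT CB => h; rewrite (subpartition_disjoint sF BF CF h).
split.
  apply: subpartitionI => [X Y|].
    rewrite !inE => /orP[/imsetP[A AA ->]|XF] /orP[/imsetP[A' AA' ->]|YF].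
    - move=> h; congr (_ :&: _); apply: (subpartition_disjoint sA AA AA' _).
      apply: contraNneq h => h; rewrite setIACA h setI0; exact: eqxx.
    - by rewrite sub_disj ?inE ?eqxx.
    - by rewrite setIC sub_disj ?inE ?eqxx.
    - by case/andP: XF YF => _ XF /andP[_ YF]; apply: subpartition_disjoint sF XF YF.
  rewrite !inE negb_or; apply/andP; split.
    by apply/imsetP => -[A AA /esym/eqP]; apply/negP/mA.
  by rewrite negb_and; case/andP: sF => _ ->; rewrite orbT.
move=> f; rewrite /total (eq_bigl [predU [set B :&: A | A in As] & F :\ B]); last first.
  by move=> W; rewrite !inE.
rewrite bigU /=; last first.
  rewrite disjoints_subset; apply/subsetP => X /imsetP[A AA ->]; rewrite inE.
  by apply/negP => /sub_disj/(_ A)/eqP; rewrite setIid; apply/negP/mA.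
by rewrite big_imset // [in RHS](big_setD1 B) //= -addrA addrC (addrC (f B)).
Qed.

Lemma subpartition_join (T : finType) (F As : {set {set T}}) (B : {set T}) :
  subpartition F -> As \subset F -> B != set0 ->
  (forall A, A \in F -> B :&: A != set0 -> A \in As) ->
  let F' : {set {set T}} := (B :|: cover As) |: (F :\: As) in
  subpartition F' /\
  forall f : {set T} -> int,
    total f F' + total f As = total f F + f (B :|: cover As).
Proof.
move=> sF sAF nB mA F'.
have [] := @subpartitionU1 _ (F :\: As) (B :|: cover As).
- exact: subpartition_sub (subsetDl _ _) sF.
- by apply: contraNneq nB => /eqP; rewrite setU_eq0 => /andP[].
- move=> A /setDP[AF nAA]; apply/eqP; rewrite setIUl setU_eq0; apply/andP; split.
    by apply: contraNT nAA; apply: mA.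
  apply/set0Pn => -[x /setIP[/bigcupP[A' AA' xA'] xA]]; case/negP: nAA.
  rewrite (_ : A = A') //; apply: (subpartition_disjoint sF AF).
    exact: (subsetP sAF).
  by apply/set0Pn; exists x; rewrite inE xA.
move=> sF' nK; split=> // f; by rewrite totalU1 // (totalID f sAF); lia.
Qed.


(** * Sub- and supermodular inequalities for a set and disjoint cells *)

Lemma cover_setD1_disjoint (T : finType) (As : {set {set T}}) (A B : {set T}) :
  trivIset As -> A \in As -> (B :|: cover (As :\ A)) :&: A = B :&: A.
Proof.
move=> tA AA; rewrite setIUl [X in _ :|: X](_ : _ = set0) ?setU0 //.
apply/eqP; rewrite -subset0; apply/subsetP => x.
move=> /setIP[/bigcupP[C /setD1P[CA CAs] xC] xA].
have /trivIsetP/(_ C A CAs AA CA) := tA.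
by rewrite -setI_eq0 => /eqP <-; rewrite inE xC.
Qed.

(** The cells are absorbed into [B] one at a time: disjoint from those absorbed before, a new cell
    [A] meets the current union exactly in [B :&: A]. *)
Lemma submodular_star (T : finType) (f : {set T} -> int)
    (As : {set {set T}}) (B : {set T}) :
  (forall X Y, f (X :&: Y) + f (X :|: Y) <= f X + f Y) -> trivIset As ->
  f (B :|: cover As) + total (fun A => f (B :&: A)) As <= f B + total f As.
Proof.
move=> fsub; have [n] := ubnP #|As|; elim: n As => // n IH As; rewrite ltnS.
move=> cA tA; have [->|[A AA]] := set_0Vmem As.
  by rewrite !total0 /cover big_set0 setU0.
have := IH (As :\ A); rewrite (cardsD1 A) AA in cA => /(_ cA).
move=> /(_ (trivIsetS (subsetDl _ _) tA)).
have := fsub (B :|: cover (As :\ A)) A; rewrite cover_setD1_disjoint //.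
rewrite -setUA [_ :|: A]setUC !(totalD1 _ AA).
rewrite (_ : A :|: _ = cover As); last by rewrite /cover (big_setD1 A AA).
lia.
Qed.

(** The cells are absorbed as in [submodular_star], but the inequality for [p] applies only while
    the current union has positive value. Once that value is nonpositive, dropping it from the
    inequality reached so far leaves the second alternative. *)
Lemma intersecting_star (T : finType) (p : {set T} -> int)
    (As : {set {set T}}) (B : {set T}) :
  pos_intersecting_supermodular p -> trivIset As -> 0 < p B ->
  (forall A, A \in As -> 0 < p A) -> (forall A, A \in As -> B :&: A != set0) ->
  p B + total p As
    <= p (B :|: cover As) + total (fun A => p (B :&: A)) As \/
  exists2 As' : {set {set T}}, As' \subset As /\ As' != set0 &
    p B + total p As' <= total (fun A => p (B :&: A)) As'.
Proof.
move=> hp; have [n] := ubnP #|As|; elim: n As => // n IH As; rewrite ltnS => cA.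
move=> tA pB pA mA; have [->|[A AA]] := set_0Vmem As.
  by left; rewrite !total0 /cover big_set0 setU0.
have sA : As :\ A \subset As by apply: subsetDl.
have DA C : C \in As :\ A -> C \in As by apply: (subsetP sA).
have [|||||IHA|[As' [sA' nA'] IHA]] := IH (As :\ A).
- by move: cA; rewrite (cardsD1 A) AA.
- exact: trivIsetS tA.
- exact: pB.
- by move=> C /DA; apply: pA.
- by move=> C /DA; apply: mA.
- have [pX|pX] := ltrP 0 (p (B :|: cover (As :\ A))).
    left; have := hp (B :|: cover (As :\ A)) A.
    rewrite cover_setD1_disjoint // mA // => /(_ isT pX (pA _ AA)).
    move: IHA; rewrite -setUA [_ :|: A]setUC !(totalD1 _ AA).
    rewrite (_ : A :|: _ = cover As); last by rewrite /cover (big_setD1 A AA).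
    lia.
  right; exists (As :\ A); last by move: IHA pX; lia.
  (* With no cell absorbed, the union is [B], whose value is positive. *)
  split=> //; apply: contraTneq pX => ->.
  by rewrite /cover big_set0 setU0 -ltNge.
- by right; exists As' => //; split=> //; apply: subset_trans sA.
Qed.

(** * Excess, hits and weights *)

Definition excess (T : finType) (p : {set T} -> int) (g : nat -> nat)
    (Z : {set T}) (F : {set {set T}}) : int :=
  total p F - total (hit Z) F - (g #|F|)%:Z.

(* Decreases at every uncrossing step of a sequence of families, i being the
   position in the sequence: dropping a cell is worth more than moving one to a
   later family, and the latter more than any change of the cell sizes. *)
Definition weight (T : finType) (r i : nat) (F : {set {set T}}) : nat :=
  ((r.+1 - i) * #|T|.+1 * #|F| + i * size_sum F)%N.

Lemma hit_ge0 (T : finType) (Z W : {set T}) : 0 <= hit Z W.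
Proof. by []. Qed.

Lemma hit_sub (T : finType) (Z A B : {set T}) :
  A \subset B -> hit Z A <= hit Z B.
Proof.
move=> sAB; rewrite lez_nat; case: eqVneq => // nA.
rewrite [_ != _](_ : _ = true) //; apply: contraNneq nA => B0.
by rewrite -subset0 -B0 setSI.
Qed.

Lemma hit_submodular (T : finType) (Z X Y : {set T}) :
  hit Z (X :&: Y) + hit Z (X :|: Y) <= hit Z X + hit Z Y.
Proof.
have := hit_sub Z (subsetIl X Y); have := hit_sub Z (subsetIr X Y).
rewrite /hit [(X :|: Y) :&: Z]setIUl setU_eq0 negb_and.
by do 3!case: (_ != set0).
Qed.

Lemma card_submodular (T : finType) (X Y : {set T}) :
  #|X :&: Y|%:Z + #|X :|: Y|%:Z <= #|X|%:Z + #|Y|%:Z :> int.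
Proof. by have := cardsUI X Y; lia. Qed.

Lemma subpartition_size (T : finType) (F : {set {set T}}) :
  subpartition F -> (size_sum F <= #|T|)%N.
Proof. by case/andP => /eqP tF _; rewrite /size_sum tF; apply: max_card. Qed.

Lemma card_star (T : finType) (As : {set {set T}}) (B : {set T}) :
  trivIset As ->
  #|B :|: cover As|%:Z + total (fun A => #|B :&: A|%:Z) As
    <= #|B|%:Z + total (fun A => #|A|%:Z) As.
Proof. exact: (submodular_star B (@card_submodular T)). Qed.

Lemma total_card_setI (T : finType) (As : {set {set T}}) (B : {set T}) :
  trivIset As -> total (fun A => #|B :&: A|%:Z) As <= #|B|%:Z.
Proof.
move=> tAs; have := card_star B tAs; rewrite total_size /size_sum (eqP tAs).
by have := subset_leq_card (subsetUr B (cover As)); lia.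
Qed.

(** With [d = j - i], the [a - 1] cells passing to the later position save [d * c] each; the second
    family loses [b - m] points at rate [j], while the first gains at most as many at rate [i]. The
    last hypothesis makes one of these savings positive. *)
Lemma weight_star r i j c f1 f2 f1' f2' s1 s2 s1' s2' a k b m sA :
  (i < j <= r)%N -> (f1' + a = f1 + 1)%N -> (f2' + 1 = f2 + a)%N ->
  (s1' + sA = s1 + k)%N -> (s2' + b = s2 + m)%N -> (k + m <= b + sA)%N ->
  (m <= b)%N -> (0 < c)%N -> (0 < a)%N -> ((1 < a) || (m < b))%N ->
  ((r.+1 - i) * c * f1' + i * s1' + ((r.+1 - j) * c * f2' + j * s2') <
   (r.+1 - i) * c * f1 + i * s1 + ((r.+1 - j) * c * f2 + j * s2))%N.
Proof.
move=> /andP[ij jr] h1 h2 h3 h4 h5 h6 h7 h8 h9.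
have [d jE d0] : exists2 d, j = (i + d)%N & (0 < d)%N by exists (j - i)%N; lia.
subst j.
have [u -> ->] :
    exists2 u, (r.+1 - i)%N = (d + u)%N & (r.+1 - (i + d))%N = u.
  by exists (r.+1 - i - d)%N; lia.
have [x xE] : exists x, a = x.+1 by exists a.-1; lia.
have [y yE] : exists y, b = (m + y)%N by exists (b - m)%N; lia.
subst.
have e1 : f1 = (f1' + x)%N by lia.
have e2 : f2' = (f2 + x)%N by lia.
have e3 : s2 = (s2' + y)%N by lia.
have e4 : (s1' <= s1 + y)%N by lia.
subst.
have : (i * s1' <= i * (s1+y))%N by rewrite leq_mul2l e4 orbT.
have : (0 < d * (x * c + y))%N by rewrite muln_gt0 d0 addn_gt0 muln_gt0 h7 andbT; lia.
rewrite !mulnDl !mulnDr; lia.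
Qed.

Lemma weight_drop r i j c f1 f2 f1' f2' s1 s2 s1' s2' a :
  (i < j <= r)%N -> (f1' + a = f1)%N -> (f2' + 1 = f2 + a)%N ->
  (s1' <= s1)%N -> (s2' <= s2)%N -> (0 < c)%N -> (0 < a)%N ->
  ((r.+1 - i) * c * f1' + i * s1' + ((r.+1 - j) * c * f2' + j * s2') <
   (r.+1 - i) * c * f1 + i * s1 + ((r.+1 - j) * c * f2 + j * s2))%N.
Proof.
move=> /andP[ij jr] h1 h2 h3 h4 h5 h6.
have [d jE d0] : exists2 d, j = (i + d)%N & (0 < d)%N by exists (j - i)%N; lia.
subst j.
have [u -> [-> u0]] : exists2 u, (r.+1 - i)%N = (d + u)%N &
    (r.+1 - (i + d))%N = u /\ (0 < u)%N.
  by exists (r.+1 - i - d)%N; lia.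
have [x xE] : exists x, a = x.+1 by exists a.-1; lia.
subst.
have e2 : f2' = (f2 + x)%N by lia.
subst.
have : (i * s1' <= i * s1)%N by rewrite leq_mul2l h3 orbT.
have : ((i+d) * s2' <= (i+d) * s2)%N by rewrite leq_mul2l h4 orbT.
have : (0 < u * c)%N by rewrite muln_gt0 u0.
nia.
Qed.

Lemma weight_move r i j c f1 f2 s1 s2 a :
  (i < j <= r)%N -> (a < c)%N ->
  ((r.+1 - i) * c * f1 + i * s1 + ((r.+1 - j) * c * (f2+1) + j * (a+s2)) <
   (r.+1 - i) * c * (f1+1) + i * (a+s1) + ((r.+1 - j) * c * f2 + j * s2))%N.
Proof.
move=> /andP[ij jr] h1.
have [d jE d0] : exists2 d, j = (i + d)%N & (0 < d)%N by exists (j - i)%N; lia.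
subst j.
have [u -> ->] :
    exists2 u, (r.+1 - i)%N = (d + u)%N & (r.+1 - (i + d))%N = u.
  by exists (r.+1 - i - d)%N; lia.
have : (d * a < d * c)%N by rewrite ltn_mul2l d0.
nia.
Qed.

(** The factor [t.+1] per cell exceeds any difference of the total sizes, both at most [t], so the
    surplus of cells decides. *)
Lemma weight_swap r i j t f1 f2 s1 s2 :
  (i < j <= r)%N -> (f2 < f1)%N -> (s1 <= t)%N -> (s2 <= t)%N ->
  ((r.+1 - i) * t.+1 * f2 + i * s2 + ((r.+1 - j) * t.+1 * f1 + j * s1) <
   (r.+1 - i) * t.+1 * f1 + i * s1 + ((r.+1 - j) * t.+1 * f2 + j * s2))%N.
Proof.
move=> /andP[ij jr] h1 h2 h3.
have [d jE d0] : exists2 d, j = (i + d)%N & (0 < d)%N by exists (j - i)%N; lia.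
subst j.
have [u -> ->] :
    exists2 u, (r.+1 - i)%N = (d + u)%N & (r.+1 - (i + d))%N = u.
  by exists (r.+1 - i - d)%N; lia.
have [e ->] : exists e, f1 = (f2 + e.+1)%N by exists (f1 - f2).-1; lia.
have : (d * s1 <= d * t)%N by rewrite leq_mul2l h2 orbT.
nia.
Qed.

(** * Uncrossing two families *)

Lemma excess_exchange (T : finType) (p : {set T} -> int) g Z
    (F1 F2 F1' F2' : {set {set T}}) :
  total p F1 + total p F2 <= total p F1' + total p F2' ->
  total (hit Z) F1' + total (hit Z) F2'
    <= total (hit Z) F1 + total (hit Z) F2 ->
  (g #|F1'| + g #|F2'| <= g #|F1| + g #|F2|)%N ->
  excess p g Z F1 + excess p g Z F2 <= excess p g Z F1' + excess p g Z F2'.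
Proof. by rewrite /excess; lia. Qed.

(** Concavity in the shape uncrossing needs: a pair of family sizes is spread by [x], and [x <= a]
    keeps the subtraction exact. *)
Definition concave_nat (g : nat -> nat) :=
  forall x a b, (x <= a)%N -> (a <= b)%N -> (g (a - x) + g (b + x) <= g a + g b)%N.

(* The four steps: exchange the families if the larger one comes first; refine
   a cell B of F2 by the cells As of F1 it meets, which are merged with B (or
   deleted, when a partial union has nonpositive value, so that supermodularity
   stops applying); move a cell of F1 missed by F2 to F2. *)
Lemma uncross (T : finType) (p : {set T} -> int) (g : nat -> nat)
    (F1 F2 : {set {set T}}) :
  pos_intersecting_supermodular p ->
  {homo g : a b / (a <= b)%N} -> concave_nat g ->
  subpartition F1 -> subpartition F2 ->
  (forall W, W \in F1 -> 0 < p W) -> (forall W, W \in F2 -> 0 < p W) ->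
  (forall A, A \in F1 -> exists2 B, B \in F2 & B \subset A) \/
  exists F1' F2', [/\ subpartition F1', subpartition F2',
    forall Z, excess p g Z F1 + excess p g Z F2
              <= excess p g Z F1' + excess p g Z F2' &
    forall r i j, (i < j <= r)%N ->
      (weight r i F1' + weight r j F2' < weight r i F1 + weight r j F2)%N].
Proof.
move=> hp gmono gconc s1 s2 p1 p2.
(* After the exchange case, [le12] is the order of sizes under which concavity of [g] applies in all
   later steps. *)
have [lt21|le12] := ltnP #|F2| #|F1|.
  right; exists F2, F1; split=> // [Z|r i j /andP[ij jr]]; first by rewrite addrC.
  by apply: weight_swap; rewrite ?ij ?subpartition_size.
(* Such a [B] meets a cell of [F1] but lies in none. Without one, every cell of [F2] meeting a cell
   of [F1] lies inside some cell of [F1]. *)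
have [/existsP[B /existsP[A0]]|noB] :=
    boolP [exists B, exists A, [&& B \in F2, A \in F1, B :&: A != set0 &
      [forall A' in F1, ~~ (B \subset A')]]].
  move=> /and4P[BF2 A0F1 BA0 /forall_inP nB]; right.
  pose As := [set A in F1 | B :&: A != set0].
  have sAs : As \subset F1 by apply/subsetP => A; rewrite inE => /andP[].
  have mAs A : A \in As -> B :&: A != set0 by rewrite inE => /andP[].
  have AsF1 A : A \in As -> A \in F1 by apply: (subsetP sAs).
  have spAs := subpartition_sub sAs s1.
  have tAs : trivIset As by case/andP: spAs.
  have nB0 : B != set0 by apply: subpartition_neq0 s2 BF2.
  have [|hK|[As' [sA' nA'] hK]] :=
      intersecting_star hp tAs (p2 _ BF2) _ mAs.
  - by move=> A /AsF1; apply: p1.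
  (* [K] replaces [As] in [F1], and the traces [B :&: A] replace [B] in [F2]: the sizes change by
     [#|As| - 1] in opposite directions. *)
  - have [|sp1 e1] := @subpartition_join _ F1 As B s1 sAs nB0.
      by move=> A AF1 BA; rewrite inE AF1.
    have [sp2 e2] := subpartition_refine s2 BF2 spAs mAs.
    set K := B :|: cover As in hK e1 sp1.
    set F1' : {set {set T}} := K |: _ in e1 sp1.
    set F2' : {set {set T}} := _ :|: _ in e2 sp2.
    have c1 := e1 (fun=> 1); have c2 := e2 (fun=> 1).
    rewrite !total_card in c1 c2.
    have z1 := e1 (fun W => #|W|%:Z); have z2 := e2 (fun W => #|W|%:Z).
    have z3 := card_star B tAs; have z4 := total_card_setI B tAs.
    rewrite !total_size in z1 z2 z3.
    have As0 : (0 < #|As|)%N by apply/card_gt0P; exists A0; rewrite inE A0F1.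
    exists F1', F2'; split=> // [Z|r i j /andP[ij jr]].
      apply: excess_exchange.
      - by move: hK (e1 p) (e2 p); clear; lia.
      - move: (e1 (hit Z)) (e2 (hit Z)) (submodular_star B (hit_submodular Z) tAs).
        by rewrite -/K; clear; lia.
      - rewrite (_ : #|F1'| = #|F1| - #|As|.-1)%N; last by move: c1 As0; clear; lia.
        rewrite (_ : #|F2'| = #|F2| + #|As|.-1)%N; last by move: c2 As0; clear; lia.
        by apply: gconc => //; apply: leq_trans (leq_pred _) (subset_leq_card sAs).
    have mE := total_nat (fun A => #|B :&: A|) As.
    rewrite -/K mE in z2 z3 z4.
    set m := (\sum_(A in As) _)%N in mE z2 z3 z4.
    (* If [B] meets a single cell, it is not contained in it, so its trace there is smaller than
       [B]. *)
    have strict : (1 < #|As|)%N || (m < #|B|)%N.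
      have [//||/esym/eqP/cards1P[A AsE]] := ltngtP 1 #|As|.
        by rewrite ltnNge As0.
      rewrite /m AsE big_set1 proper_card // properEneq subsetIl andbT.
      have /AsF1/nB : A \in As by rewrite AsE set11.
      by apply: contraNneq => BE; apply/setIidPl.
    apply: (@weight_star _ _ _ _ _ _ _ _ _ _ _ _ #|As| #|K| #|B| m (size_sum As));
      rewrite ?ij //; by move: c1 c2 z1 z2 z3 z4; clear; lia.
  - have sA1 : As' \subset F1 := subset_trans sA' sAs.
    have spA := subpartition_sub sA1 s1.
    have tA' : trivIset As' by case/andP: spA.
    have sp1 : subpartition (F1 :\: As').
      by apply: subpartition_sub (subsetDl _ _) s1.
    have [|sp2 e2] := subpartition_refine s2 BF2 spA.
      by move=> A /(subsetP sA'); apply: mAs.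
    have e1 f := totalID f sA1.
    set F2' : {set {set T}} := _ :|: _ in e2 sp2.
    set F1' : {set {set T}} := F1 :\: As' in e1 sp1.
    have c1 := e1 (fun=> 1); have c2 := e2 (fun=> 1).
    rewrite !total_card in c1 c2.
    have z1 := e1 (fun W => #|W|%:Z); have z2 := e2 (fun W => #|W|%:Z).
    have z4 := total_card_setI B tA'.
    rewrite !total_size in z1 z2.
    have As0 : (0 < #|As'|)%N by rewrite card_gt0.
    exists F1', F2'; split=> // [Z|r i j /andP[ij jr]].
      apply: excess_exchange.
      - by move: hK (e1 p) (e2 p); clear; lia.
      - have := e1 (hit Z); have := e2 (hit Z).
        have : total (fun A => hit Z (B :&: A)) As' <= total (hit Z) As'.
          by apply: ler_sum => A _; apply/hit_sub/subsetIr.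
        by move: (hit_ge0 Z B); clear; lia.
      (* Spreading by [#|As'|] overshoots: [F2'] has one cell fewer than that, which monotonicity of
         [g] absorbs. *)
      - have := gconc #|As'| #|F1| #|F2|.
        rewrite (_ : #|F1| - #|As'| = #|F1'|)%N; last by move: c1; clear; lia.
        move=> /(_ (subset_leq_card sA1) le12); apply: leq_trans.
        by rewrite leq_add2l; apply: gmono; move: c2; clear; lia.
    apply: (@weight_drop _ _ _ _ _ _ _ _ _ _ _ _ #|As'|); rewrite ?ij //;
      by move: c1 c2 z1 z2 z4; clear; lia.
have [/existsP[A /andP[AF1 /forall_inP dA]]|meet] :=
    boolP [exists A in F1, [forall B in F2, A :&: B == set0]].
  right; have [||sp2 nA] := @subpartitionU1 _ F2 A s2.
  - exact: subpartition_neq0 s1 AF1.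
  - by move=> B /dA/eqP.
  have sp1 : subpartition (F1 :\ A) by apply: subpartition_sub (subsetDl _ _) s1.
  have e1 f := totalD1 f AF1; have e2 f := totalU1 f nA.
  have c1 := e1 (fun=> 1); have c2 := e2 (fun=> 1).
  rewrite !total_card in c1 c2.
  have z1 := e1 (fun W => #|W|%:Z); have z2 := e2 (fun W => #|W|%:Z).
  rewrite !total_size in z1 z2.
  exists (F1 :\ A), (A |: F2); split=> // [Z|r i j /andP[ij jr]].
    apply: excess_exchange.
    - by rewrite e1 e2; clear; lia.
    - by rewrite (e1 (hit Z)) e2; clear; lia.
    - rewrite (_ : #|_ :\ _| = #|F1| - 1)%N; last by move: c1 c2 z1 z2; clear; lia.
      rewrite (_ : #|_ |: _| = #|F2| + 1)%N; last by move: c1 c2 z1 z2; clear; lia.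
      by apply: gconc => //; move: AF1 c1; clear; lia.
  rewrite /weight (_ : #|F1| = #|F1 :\ A| + 1)%N; last by move: c1 c2 z1 z2; clear; lia.
  rewrite (_ : #|_ |: _| = #|F2| + 1)%N; last by move: c1 c2 z1 z2; clear; lia.
  rewrite (_ : size_sum F1 = #|A| + size_sum (F1 :\ A))%N; last first.
    by move: c1 c2 z1 z2; clear; lia.
  rewrite (_ : size_sum (_ |: _) = #|A| + size_sum F2)%N; last first.
    by move: c1 c2 z1 z2; clear; lia.
  by apply: weight_move; rewrite ?ij // ltnS max_card.
(* No step applies: [A] meets some [B] of [F2], which lies in a cell of [F1]; that cell meets [A],
   hence equals [A]. *)
left=> A AF1; move: meet; rewrite negb_exists_in => /forall_inP/(_ A AF1).
rewrite negb_forall_in => /exists_inP[B BF2 AB].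
move: noB; rewrite negb_exists => /forallP/(_ B); rewrite negb_exists.
move=> /forallP/(_ A); rewrite BF2 AF1 setIC AB /= negb_forall_in.
move=> /exists_inP[A' A'F1]; rewrite negbK => BA'; exists B => //.
rewrite (_ : A = A') //; apply: (subpartition_disjoint s1) => //.
apply: contraNneq AB => AA'; rewrite -subset0 -AA' setIS //.
Qed.

(** * Uncrossing a sequence of families *)

Definition update (A : Type) (phi : nat -> A) (i : nat) (x : A) : nat -> A :=
  fun k => if k == i then x else phi k.

Lemma sum_update (A : Type) (f : nat -> A -> int) (phi : nat -> A) r i x :
  (i < r)%N ->
  \sum_(k < r) f k (update phi i x k) + f i (phi i) =
  \sum_(k < r) f k (phi k) + f i x.
Proof.
move=> ir; rewrite (bigD1 (Ordinal ir)) //= [in RHS](bigD1 (Ordinal ir)) //=.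
rewrite /update eqxx (eq_bigr (fun k : 'I_r => f k (phi k))).
  by rewrite addrAC [RHS]addrAC; congr (_ + _); rewrite addrC.
by move=> k; rewrite -val_eqE /= => /negPf ->.
Qed.

Lemma excess_drop (T : finType) (p : {set T} -> int) g Z (F : {set {set T}}) A :
  {homo g : a b / (a <= b)%N} -> A \in F -> p A <= 0 ->
  excess p g Z F <= excess p g Z (F :\ A).
Proof.
move=> gmono AF pA; rewrite /excess (totalD1 p AF) (totalD1 (hit Z) AF).
have : (g #|F :\ A| <= g #|F|)%N by apply/gmono/subset_leq_card/subsetDl.
by move: pA (hit_ge0 Z A); clear; lia.
Qed.

Lemma hit_mono (T : finType) (Z Z' W : {set T}) :
  Z \subset Z' -> hit Z W <= hit Z' W.
Proof. by rewrite /hit ![W :&: _]setIC; apply: hit_sub. Qed.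

Lemma total_hit_unhit (T : finType) (Z W : {set T}) (F : {set {set T}}) t :
  W \in F -> hit Z W = 0 -> t \in W ->
  total (hit Z) F + 1 <= total (hit (t |: Z)) F.
Proof.
move=> WF hW tW; rewrite !(totalD1 _ WF) hW.
have -> : hit (t |: Z) W = 1.
  rewrite /hit; case: eqVneq => // /setP/(_ t).
  by rewrite !inE tW eqxx.
have : total (hit Z) (F :\ W) <= total (hit (t |: Z)) (F :\ W).
  by apply: ler_sum => A _; apply/hit_mono/subsetUr.
by move: (total _ _) (total _ _) => a b; lia.
Qed.

Lemma total_hit_card (T : finType) (Z : {set T}) (F : {set {set T}}) :
  total (hit Z) F < #|F|%:Z -> exists2 W, W \in F & hit Z W = 0.
Proof.
move=> hF; have [/exists_inP[W WF /eqP hW]|] :=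
  boolP [exists W in F, hit Z W == 0]; first by exists W.
rewrite negb_exists_in => /forall_inP h; move: hF; rewrite -total_card ltNge.
case/negP; apply: ler_sum => W /h; rewrite /hit.
by case: (W :&: Z != set0).
Qed.

(** Induction on the total weight. No step lowers the total excess, whatever the set: for [Z] this
    keeps the lower bound on the total, and for [t |: Z] it carries the upper bound back to the
    original families. *)
Lemma families_free_point (T : finType) (p : {set T} -> int) (g : nat -> nat)
    (Z : {set T}) (mu : int) (r : nat) (phi : nat -> {set {set T}}) :
  pos_intersecting_supermodular p ->
  {homo g : a b / (a <= b)%N} -> concave_nat g ->
  (forall F : {set {set T}}, subpartition F -> excess p g Z F <= mu) ->
  (forall F : {set {set T}}, subpartition F ->
     total p F <= (g #|F|)%:Z + #|F|%:Z) ->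
  0 < mu -> (0 < r)%N -> (forall i, (i < r)%N -> subpartition (phi i)) ->
  mu *+ r <= \sum_(i < r) excess p g Z (phi i) ->
  exists t, \sum_(i < r) excess p g (t |: Z) (phi i) <= (mu - 1) *+ r.
Proof.
move=> hp gmono gconc hmu hcard mu0 r0.
pose wt (psi : nat -> {set {set T}}) : int :=
  \sum_(i < r) (weight r i (psi i))%:Z.
have [n] : exists n : nat, wt phi < n%:Z.
  by exists `|wt phi|.+1%N; lia.
elim: n phi => [|n IH] phi.
  by rewrite ltNge sumr_ge0.
move=> hn sphi tphi.
have step phi' : (forall i, (i < r)%N -> subpartition (phi' i)) ->
    (forall Z', \sum_(i < r) excess p g Z' (phi i)
                <= \sum_(i < r) excess p g Z' (phi' i)) ->
    wt phi' < wt phi ->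
    exists t, \sum_(i < r) excess p g (t |: Z) (phi i) <= (mu - 1) *+ r.
  move=> s' e' w'; have [|||t ht] := IH phi'.
  - by move: w' hn; clear; lia.
  - exact: s'.
  - exact: le_trans tphi (e' Z).
  - by exists t; apply: le_trans (e' _) ht.
(* Cells of nonpositive value are dropped first, as [uncross] needs positive ones. *)
have [/existsP[i /exists_inP[A Ai pA]]|pos] :=
    boolP [exists i : 'I_r, exists A in phi i, p A <= 0].
  apply: (step (update phi i (phi i :\ A))) => [j jr|Z'|].
  - rewrite /update; case: eqP => _; last exact: sphi.
    by apply: subpartition_sub (subsetDl _ _) (sphi _ _).
  - have := sum_update (fun=> excess p g Z') phi (phi i :\ A) (ltn_ord i).
    have := excess_drop Z' gmono Ai pA.
    move: (excess _ _ _ _) (excess _ _ _ _) => a b.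
    move: (\sum_(_ < _) _) (\sum_(_ < _) _) => c d; clear; lia.
  - have := sum_update (fun i F => (weight r i F)%:Z) phi (phi i :\ A) (ltn_ord i).
    have : (weight r i (phi i :\ A) < weight r i (phi i))%N.
      rewrite /weight; have := totalD1 (fun=> 1) Ai.
      have := totalD1 (fun W => #|W|%:Z) Ai; rewrite !total_card !total_size.
      move=> zS zC.
      have -> : #|phi i| = (1 + #|phi i :\ A|)%N by move: zC; clear; lia.
      have -> : size_sum (phi i) = (#|A| + size_sum (phi i :\ A))%N.
        by move: zS; clear; lia.
      have : (0 < (r.+1 - i) * #|T|.+1)%N.
        by rewrite muln_gt0 subn_gt0 andbT; apply: (leq_trans (ltn_ord i)).
      by move: (size_sum _) => s; clear; nia.
    rewrite -/(wt phi) -/(wt (update phi i (phi i :\ A))).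
    by move: (wt _) (wt _) => a b; clear; lia.
have ppos i A : (i < r)%N -> A \in phi i -> 0 < p A.
  move=> ir Ai; rewrite ltNge; apply: contra pos => pA.
  by apply/existsP; exists (Ordinal ir); apply/exists_inP; exists A.
have [chain|//] : (forall i j A, (i < j < r)%N -> A \in phi i ->
    exists2 B, B \in phi j & B \subset A) \/
    exists t, \sum_(i < r) excess p g (t |: Z) (phi i) <= (mu - 1) *+ r.
  have [/forallP chain|/forallPn[i /forallPn[j]]] :=
      boolP [forall i : 'I_r, forall j : 'I_r, (i < j)%N ==>
        [forall A in phi i, exists B in phi j, B \subset A]].
    left=> i j A /andP[ij jr] Ai; have ir := ltn_trans ij jr.
    have /forallP/(_ (Ordinal jr))/implyP/(_ ij) := chain (Ordinal ir).
    by move=> /forall_inP/(_ A Ai)/exists_inP[B Bj BA]; exists B.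
  rewrite negb_imply => /andP[ij nchain]; right.
  have [chain|[F1 [F2 [sF1 sF2 eF wF]]]] :=
      uncross hp gmono gconc (sphi _ (ltn_ord i)) (sphi _ (ltn_ord j))
        (fun A => ppos _ A (ltn_ord i)) (fun A => ppos _ A (ltn_ord j)).
    case/negP: nchain; apply/forall_inP => A /chain[B Bj BA].
    by apply/exists_inP; exists B.
  have upd_j : update phi i F1 j = phi j by rewrite /update gtn_eqF.
  apply: (step (update (update phi i F1) j F2)) => [k kr|Z'|].
  - by rewrite /update; do 2!case: eqP => // _; apply: sphi.
  - have := sum_update (fun=> excess p g Z') phi F1 (ltn_ord i).
    have := sum_update (fun=> excess p g Z') (update phi i F1) F2 (ltn_ord j).
    rewrite /= upd_j; move: (eF Z').
    do 3!move: (\sum_(_ < _) _); move: (excess _ _ _ _) => a b c d.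
    by do 3!move: (excess _ _ _ _) => ?; clear; lia.
  - have := sum_update (fun i F => (weight r i F)%:Z) phi F1 (ltn_ord i).
    have := sum_update (fun i F => (weight r i F)%:Z) (update phi i F1) F2
      (ltn_ord j).
    have /wF : (i < j <= r)%N by rewrite ij ltnW.
    rewrite /= upd_j -/(wt phi) -/(wt (update phi i F1)).
    by rewrite -/(wt (update (update phi i F1) j F2)); clear; lia.
(* The average excess is at least [mu] and no excess exceeds it. *)
have tight i : (i < r)%N -> excess p g Z (phi i) = mu.
  move=> ir.
  have h0 : \sum_(i < r) (mu - excess p g Z (phi i)) = 0.
    apply/eqP; rewrite eq_le sumr_ge0 ?andbT => [|k _].
      by rewrite sumrB sumr_const card_ord subr_le0.
    by rewrite subr_ge0 hmu ?sphi.
  have ge0 (k : 'I_r) : true -> 0 <= mu - excess p g Z (phi k).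
    by rewrite subr_ge0 hmu ?sphi.
  have /eqP : mu - excess p g Z (phi (Ordinal ir)) = 0.
    exact: (psumr_eq0P ge0 h0).
  by rewrite subr_eq0 => /eqP.
(* By [hcard] the excess is at most the number of cells not hit; as it equals [mu > 0], some cell is
   missed. *)
have [W0 W0phi hW0] : exists2 W, W \in phi 0%N & hit Z W = 0.
  apply: total_hit_card; have := tight _ r0; have := hcard _ (sphi _ r0).
  by rewrite /excess; move: mu0; clear; lia.
(* Descending the chain from [W0] only meets missed cells, since a subset of a missed set is missed;
   the induction on [k] remembers the cells passed. *)
have [W [Wphi Wsub]] : exists W, W \in phi r.-1 /\
    forall i, (i < r)%N -> exists W', [/\ W' \in phi i, hit Z W' = 0 & W \subset W'].
  have : forall k, (k < r)%N -> exists W, [/\ W \in phi k, hit Z W = 0 &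
      forall i, (i <= k)%N ->
        exists W', [/\ W' \in phi i, hit Z W' = 0 & W \subset W']].
    elim=> [|k IHk] kr.
      by exists W0; split=> // i; rewrite leqn0 => /eqP ->; exists W0.
    have [W [Wk hW Wsub]] := IHk (ltnW kr).
    have [|V Vk VW] := chain k k.+1 W _ Wk; first by rewrite ltnSn.
    have hV : hit Z V = 0.
      by have := hit_sub Z VW; rewrite hW /hit; case: (V :&: Z != set0).
    exists V; split=> // i; rewrite leq_eqVlt => /predU1P[->|]; first by exists V.
    rewrite ltnS => /Wsub[W' [W'i hW' WW']].
    by exists W'; split=> //; apply: subset_trans WW'.
  move=> /(_ r.-1) [|W [Wk _ Wsub]]; first by rewrite prednK.
  exists W; split=> // i ir; apply: Wsub; rewrite -ltnS prednK //.
have sr : subpartition (phi r.-1) by apply: sphi; rewrite prednK.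
(* Any point of [W] lies in a missed cell of every family, so adding it to [Z] lowers every excess
   by at least one. *)
have /set0Pn[t tW] := subpartition_neq0 sr Wphi.
exists t; rewrite -[r in _ *+ r]card_ord -sumr_const; apply: ler_sum => i _.
have [W' [W'i hW' /subsetP/(_ t tW) tW']] := Wsub i (ltn_ord i).
have := total_hit_unhit W'i hW' tW'; have := tight i (ltn_ord i).
by rewrite /excess; clear; lia.
Qed.

(** * Growing the neighbourhood of one node *)

Lemma hitU1_notin (T : finType) (Z W : {set T}) t :
  t \notin W -> hit (t |: Z) W = hit Z W.
Proof.
move=> tW; rewrite /hit setIUr (_ : W :&: [set t] = set0) ?set0U //.
by apply/eqP; rewrite setI_eq0 disjoint_sym disjoints1.
Qed.

(** By disjointness [t] lies in at most one cell, and only that cell can become hit. *)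
Lemma total_hitU1 (T : finType) (Z : {set T}) (F : {set {set T}}) t :
  subpartition F -> total (hit (t |: Z)) F <= total (hit Z) F + 1.
Proof.
move=> sF; have [/exists_inP[W WF tW]|] := boolP [exists W in F, t \in W].
  rewrite !(totalD1 _ WF).
  have -> : total (hit (t |: Z)) (F :\ W) = total (hit Z) (F :\ W).
    apply: eq_bigr => A /setD1P[AW AF]; apply: hitU1_notin.
    apply: contra AW => tA; apply/eqP/(subpartition_disjoint sF AF WF).
    by apply/set0Pn; exists t; rewrite inE tA.
  rewrite addrAC lerD2r /hit; case: (W :&: (t |: Z) != set0) => //=.
  by case: (W :&: Z != set0).
rewrite negb_exists_in => /forall_inP h.
rewrite (_ : total (hit (t |: Z)) F = total (hit Z) F) ?lerDl //.
by apply: eq_bigr => W /h; apply: hitU1_notin.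
Qed.

Lemma excess_subset (T : finType) (p : {set T} -> int) g (Z Z' : {set T})
    (F : {set {set T}}) :
  Z \subset Z' -> excess p g Z' F <= excess p g Z F.
Proof.
move=> sZ; rewrite /excess lerD2r lerD2l lerN2.
by apply: ler_sum => W _; apply: hit_mono.
Qed.

(** Otherwise each [t] has a family whose excess for [t |: Z] still exceeds [mu - 1]. For the point
    [t] given by [families_free_point], the other families keep at least [mu - 1], since one point
    costs at most one; the total is then too large. *)
Lemma augment (T : finType) (p : {set T} -> int) (g : nat -> nat)
    (Z : {set T}) (mu : int) :
  pos_intersecting_supermodular p ->
  {homo g : a b / (a <= b)%N} -> concave_nat g ->
  (forall F : {set {set T}}, subpartition F -> excess p g Z F <= mu) ->
  (forall F : {set {set T}}, subpartition F ->
     total p F <= (g #|F|)%:Z + #|F|%:Z) ->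
  0 < mu -> (#|Z| < #|T|)%N ->
  exists2 t, t \notin Z & forall F : {set {set T}}, subpartition F ->
    excess p g (t |: Z) F <= mu - 1.
Proof.
move=> hp gmono gconc hmu hcard mu0 cZ.
have [/existsP[t /andP[tZ /forallP ht]]|/existsPn none] :=
    boolP [exists t, (t \notin Z) &&
      [forall F : {set {set T}}, subpartition F ==> (excess p g (t |: Z) F <= mu - 1)]].
  by exists t => // F sF; apply: (implyP (ht F)).
have bad t : t \notin Z ->
    exists F : {set {set T}}, subpartition F /\ mu - 1 < excess p g (t |: Z) F.
  move=> tZ; have := none t; rewrite tZ => /forallPn[F].
  by rewrite negb_imply -ltNge => /andP[sF hF]; exists F.
have [t0 t0Z] : exists t0, t0 \notin Z.
  have /set0Pn[t tZ] : ~: Z != set0.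
    by rewrite -card_gt0; have := cardsC Z; move: cZ; clear; lia.
  by exists t; rewrite inE in tZ.
(* Points of [Z] receive a family too, that of [t0], because [families_free_point] does not place
   its point outside [Z]. *)
have [|F hF] := @fin_all_exists T (fun=> {set {set T}})
    (fun t F => subpartition F /\ mu - 1 < excess p g (t |: Z) F).
  move=> t; have [tZ|/bad//] := boolP (t \in Z).
  have [F [sF hF]] := bad _ t0Z; exists F; split=> //.
  rewrite (setUidPr _) ?sub1set //; apply: lt_le_trans hF _.
  exact/excess_subset/subsetUr.
(* [t0] is only the default of [nth]; the positions below [#|T|] enumerate all points. *)
pose phi k := F (nth t0 (enum T) k).
have phiE (i : 'I_#|T|) : phi i = F (enum_val i).
  by rewrite /phi (enum_val_nth t0).
have lb (i : 'I_#|T|) : mu <= excess p g Z (phi i).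
  rewrite phiE; have [_ h] := hF (enum_val i).
  have := excess_subset p g (F (enum_val i)) (subsetUr [set enum_val i] Z).
  by move: h; clear; lia.
have T0 : (0 < #|T|)%N by apply/card_gt0P; exists t0.
have [i iT||t] :=
  @families_free_point T p g Z mu #|T| phi hp gmono gconc hmu hcard mu0 T0.
- by case: (hF (nth t0 (enum T) i)).
- by rewrite -[X in _ *+ X]card_ord -sumr_const; apply: ler_sum => i _; apply: lb.
rewrite leNgt => /negP[]; rewrite -[X in _ *+ X]card_ord -sumr_const.
rewrite (bigD1 (enum_rank t)) //= [ltRHS](bigD1 (enum_rank t)) //=.
apply: ltr_leD; first by rewrite phiE enum_rankK; case: (hF t).
apply: ler_sum => i _; have := lb i.
have : subpartition (phi i) by rewrite phiE; case: (hF (enum_val i)).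
by move=> /(total_hitU1 Z t); rewrite /excess; move: (phi i) => G; clear; lia.
Qed.

(** Here [g] is the contribution of the remaining nodes. The bound [m] on the minimum starts the
    construction at the empty set with excess at most [m], lowered by one with each point; the bound
    [#|F|] gives the other hypothesis of [augment]. *)
Lemma exists_neighborhood (T : finType) (p : {set T} -> int) (g : nat -> nat)
    (m : nat) :
  pos_intersecting_supermodular p ->
  {homo g : a b / (a <= b)%N} -> concave_nat g -> (m <= #|T|)%N ->
  (forall F : {set {set T}}, subpartition F ->
     total p F <= (g #|F|)%:Z + (minn m #|F|)%:Z) ->
  exists2 Z : {set T}, #|Z| = m & forall F : {set {set T}}, subpartition F ->
    total p F - total (hit Z) F <= (g #|F|)%:Z.
Proof.
move=> hp gmono gconc mT hm.
have hcard (F : {set {set T}}) : subpartition F ->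
    total p F <= (g #|F|)%:Z + #|F|%:Z.
  by move=> /hm /le_trans; apply; rewrite lerD2l lez_nat geq_minr.
have build k : (k <= m)%N -> exists2 Z : {set T}, #|Z| = k &
    forall F : {set {set T}}, subpartition F -> excess p g Z F <= (m - k)%N%:Z.
  elim: k => [|k IH] km.
    exists set0; first exact: cards0.
    move=> F sF; rewrite /excess.
    have -> : total (hit set0) F = 0.
      by apply: big1 => W _; rewrite /hit setI0 eqxx.
    by have := hm F sF; have := geq_minl m #|F|; clear; lia.
  have [Z cZ hZ] := IH (ltnW km).
  have [||t tZ ht] := augment hp gmono gconc hZ hcard.
  - by rewrite ltz_nat subn_gt0.
  - by rewrite cZ; apply: leq_trans mT.
  - exists (t |: Z); first by rewrite cardsU1 tZ cZ.
    by move=> F /ht; move: km; clear; lia.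
have [Z cZ hZ] := build m (leqnn m).
by exists Z => // F /hZ; rewrite /excess subnn subr_le0.
Qed.

(** * Neighbourhoods for all nodes *)

Definition truncated_sum (S : Type) (mS : S -> nat) (r : seq S) (q : nat) : nat :=
  \sum_(s <- r) minn (mS s) q.

Lemma truncated_sum_homo (S : Type) (mS : S -> nat) (r : seq S) :
  {homo truncated_sum mS r : a b / (a <= b)%N}.
Proof. by move=> a b ab; apply: leq_sum => s _; lia. Qed.

Lemma truncated_sum_concave (S : Type) (mS : S -> nat) (r : seq S) :
  concave_nat (truncated_sum mS r).
Proof.
move=> x a b xa ab; rewrite /truncated_sum -!big_split.
by apply: leq_sum => s _ /=; lia.
Qed.

(** Where [p - hit Z] is positive so is [p], and subtracting the submodular [hit Z] preserves the
    inequality. *)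
Lemma pos_intersecting_supermodular_sub_hit (T : finType) (p : {set T} -> int)
    (Z : {set T}) :
  pos_intersecting_supermodular p ->
  pos_intersecting_supermodular (fun W => p W - hit Z W).
Proof.
move=> hp X Y XY pX pY; have := hit_submodular Z X Y; have := hp X Y XY.
have := hit_ge0 Z X; have := hit_ge0 Z Y; move: pX pY.
move: (hit Z _) (hit Z _) (hit Z _) (hit Z _) => a b c d pX pY b0 a0 h.
have {}h := h ltac:(lia) ltac:(lia); lia.
Qed.

(** Induction on the list of nodes left: the first receives [Z], and the others cover what remains
    of [p]. Cells being nonempty, the bound on subpartitions says nothing about the empty set. *)
Lemma exists_neighborhoods (S : eqType) (T : finType) (mS : S -> nat) (r : seq S)
    (p : {set T} -> int) :
  pos_intersecting_supermodular p -> (forall s, (mS s <= #|T|)%N) -> uniq r ->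
  (forall F : {set {set T}}, subpartition F ->
     total p F <= (truncated_sum mS r #|F|)%:Z) ->
  exists N : S -> {set T}, (forall s, s \in r -> #|N s| = mS s) /\
    forall Y : {set T}, Y != set0 -> p Y <= \sum_(s <- r) hit (N s) Y.
Proof.
move=> + hm; elim: r p => [|s r IH] p hp /=.
  move=> _ hF; exists (fun=> set0); split=> // Y nY; rewrite big_nil.
  (* With no node left, the subpartition with single cell [Y] gives [p Y <= 0]. *)
  have [||sY _] := @subpartitionU1 _ set0 Y _ nY; first last.
  - have := hF _ sY; rewrite totalU1 ?inE // total0 addr0.
    by rewrite /truncated_sum big_nil.
  - by move=> B; rewrite inE.
  - by apply: subpartitionI => [A B|]; rewrite inE.
move=> /andP[sr ur] hF.
have [|Z cZ hZ] := exists_neighborhood hp (@truncated_sum_homo _ mS r)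
  (@truncated_sum_concave _ mS r) (hm s).
  by move=> F /hF; rewrite /truncated_sum big_cons addrC.
have [|N [cN hN]] :=
    IH _ (pos_intersecting_supermodular_sub_hit (Z := Z) hp) ur.
  by move=> F /hZ; rewrite /total sumrB.
exists (fun x => if x == s then Z else N x); split=> [x|Y nY].
  by rewrite inE; case: eqP => [-> _|_ /= /cN].
rewrite big_cons eqxx addrC -lerBlDr; apply: le_trans (hN Y nY) _.
rewrite [leLHS]big_seq [leRHS]big_seq; apply: ler_sum => x xr.
by case: eqP => // xs; rewrite -xs xr in sr.
Qed.

(** * Graphs and the equivalence of the conditions *)

Lemma sum_hit_card (S T : finType) (N : S -> {set T}) (Y : {set T}) :
  \sum_s hit (N s) Y = #|[set s | Y :&: N s != set0]|%:Z.
Proof.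
rewrite -sum1dep_card [in RHS]big_mkcond (big_morph Posz PoszD (erefl (Posz 0))).
by apply: eq_bigr => s _; rewrite /hit; case: (_ :&: _ != set0).
Qed.

Definition nbhd (S T : finType) (G : bigraph S T) (s : S) : {set T} :=
  [set t | (s, t) \in edges G].

Lemma nbrsE (S T : finType) (G : bigraph S T) (Y : {set T}) :
  nbrs G Y = [set s | Y :&: nbhd G s != set0].
Proof.
apply/setP => s; rewrite !inE; apply/exists_inP/set0Pn => -[t].
  by move=> tY st; exists t; rewrite !inE tY.
by rewrite !inE => /andP[tY st]; exists t.
Qed.

Lemma card_nbhd (S T : finType) (G : bigraph S T) (s : S) :
  #|nbhd G s| = degS G s.
Proof.
rewrite /degS -(card_imset (mem (nbhd G s)) (_ : injective (pair s))).
  apply: eq_card => -[s' t]; rewrite !inE /=; apply/imsetP/andP.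
    by move=> [t']; rewrite inE => st [-> ->].
  by move=> [st /eqP ss']; exists t; rewrite ?inE -?ss'.
by move=> t t' [].
Qed.

Lemma total_hit_le (T : finType) (Z : {set T}) (F : {set {set T}}) :
  subpartition F -> total (hit Z) F <= (minn #|Z| #|F|)%:Z.
Proof.
move=> sF; have h1 : total (hit Z) F <= #|F|%:Z.
  rewrite -total_card; apply: ler_sum => W _.
  by rewrite /hit; case: (_ :&: _ != set0).
have h2 : total (hit Z) F <= #|Z|%:Z.
  have /andP[tF _] := sF; apply: le_trans (total_card_setI Z tF).
  by apply: ler_sum => W _; rewrite /hit setIC lez_nat -card_gt0; case: #|_|.
by move: h1 h2; clear; lia.
Qed.

(** Double counting of the pairs of a cell and a node adjacent to it: a node reaches at most [#|F|]
    cells and, these being disjoint, at most as many as its degree. *)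
Lemma covers_bound (S T : finType) (G : bigraph S T) (p : {set T} -> int)
    (F : {set {set T}}) :
  covers G p -> subpartition F ->
  total p F <= (\sum_(s : S) minn (degS G s) #|F|)%N%:Z.
Proof.
move=> cG sF.
have : total p F <= \sum_(W in F) \sum_s hit (nbhd G s) W.
  by apply: ler_sum => W _; rewrite sum_hit_card -nbrsE; apply: cG.
move=> /le_trans; apply; rewrite exchange_big /=.
rewrite (big_morph Posz PoszD (erefl (Posz 0))); apply: ler_sum => s _.
by rewrite -card_nbhd; apply: total_hit_le.
Qed.

Theorem theorem13 (S T : finType) (mS : S -> nat) (gamma : nat)
    (p : {set T} -> int)
    (hgamma : (\sum_(s : S) mS s)%N = gamma)
    (hmS : forall s : S, (mS s <= #|T|)%N)
    (hp : pos_intersecting_supermodular p)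
    (hp0 : p set0 = 0) :
  let A :=
    exists G : bigraph S T, covers G p /\ (forall s : S, degS G s = mS s) in
  let B1 :=
    forall (X : {set S}) (F : {set {set T}}), subpartition F ->
      (\sum_(s in X) mS s)%N%:Z + \sum_(W in F) p W - #|F|%:Z * #|X|%:Z
        <= gamma%:Z in
  let B2 :=
    forall F : {set {set T}}, subpartition F ->
      \sum_(W in F) p W <= (\sum_(s : S) minn (mS s) #|F|)%N%:Z in
  (A <-> B1) /\ (A <-> B2).
Proof.
move=> A B1 B2.
have AB2 : A -> B2.
  move=> [G [cG dG]] F sF; have := covers_bound cG sF.
  by under eq_bigr do rewrite dG.
have B2A : B2 -> A.
  move=> b2; have [F sF|N [cN hN]] :=
      exists_neighborhoods hp hmS (index_enum_uniq S).
    exact: b2.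
  pose G := Bigraph [set e | e.2 \in N e.1].
  have NE s : nbhd G s = N s by apply/setP => t; rewrite !inE.
  exists G; split=> [Y|s]; last by rewrite -card_nbhd NE cN ?mem_index_enum.
  have [->|nY] := eqVneq Y set0; first by rewrite hp0.
  apply: le_trans (hN Y nY) _; rewrite sum_hit_card nbrsE.
  by under eq_finset do rewrite -NE.
have split_sum (X : {set S}) (f : S -> nat) : (\sum_(s : S) f s =
    \sum_(s in X) f s + \sum_(s | s \notin X) f s)%N by exact: bigID.
have B12 : B1 -> B2.
  (* [X] collects the nodes where the minimum is [#|F|]; for this choice [B1] is [B2] after
     cancelling the sum of [mS] over [X]. *)
  move=> b1 F sF; pose X := [set s | #|F| < mS s]%N.
  have -> : (\sum_(s : S) minn (mS s) #|F| =
      #|F| * #|X| + \sum_(s | s \notin X) mS s)%N.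
    rewrite (split_sum X) mulnC -sum_nat_const; congr (_ + _)%N.
      by apply: eq_bigr => s; rewrite inE => /ltnW/minn_idPr.
    by apply: eq_bigr => s; rewrite inE -leqNgt => /minn_idPl.
  have := b1 X F sF; rewrite -hgamma (split_sum X) !PoszD PoszM; clear.
  by move: (\sum_(W in F) p W) (\sum_(s in X) mS s)%N
    (\sum_(s | s \notin X) mS s)%N; lia.
have B21 : B2 -> B1.
  move=> b2 X F sF; rewrite -hgamma (split_sum X).
  have : (\sum_(s : S) minn (mS s) #|F| <=
      #|F| * #|X| + \sum_(s | s \notin X) mS s)%N.
    rewrite (split_sum X) mulnC -sum_nat_const.
    by apply: leq_add; apply: leq_sum => s _; rewrite ?geq_minr ?geq_minl.
  have := b2 F sF; rewrite !PoszD; clear.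
  move: (\sum_(W in F) p W) (\sum_(s in X) mS s)%N
    (\sum_(s | s \notin X) mS s)%N.
  by move: (\sum_s minn (mS s) #|F|)%N; lia.
by split; split; auto.
Qed.
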